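(* Let $q>2$ be a prime power and let $k,h\ge1$ be integers. Let $\mathcal S$ be a set of points of $\mathrm{PG}(k-1,q^h)$ such that $\mathcal S$ contains $k+1$ points in general position, and such that for any $k+1$ points of $\mathcal S$ in general position, the unique $q$-order subgeometry of $\mathrm{PG}(k-1,q^h)$ they determine is entirely contained in $\mathcal S$. Then $\mathcal S$ is (the point set of) a $q^r$-order subgeometry of $\mathrm{PG}(k-1,q^h)$ for some divisor $r$ of $h$.
   Context: A set of $k+1$ points of $\mathrm{PG}(k-1,q^h)$ is in general position if no $k$ of them lie in a hyperplane. For a divisor $r$ of $h$, a $q^r$-order subgeometry of $\mathrm{PG}(k-1,q^h)$ is the image, under an element of $\mathrm{PGL}_k(q^h)$, of the set of points that can be represented by a nonzero vector of $\mathbb F_{q^r}^k$. Any $k+1$ points in general position are contained in a unique $q$-order subgeometry, which is the one they determine. *)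

(* Defs.v *)
From HB Require Import structures.
From mathcomp Require Import all_boot all_order all_algebra.

Set Implicit Arguments.
Unset Strict Implicit.
Unset Printing Implicit Defensive.

Import GRing.Theory.

Local Open Scope ring_scope.

Definition prime_power (q : nat) : Prop :=
  exists p n : nat, [/\ prime p, (0 < n)%N & q = (p ^ n)%N].

(* A point of PG(k-1, F) is a 1-dimensional subspace of F^k; k is the vector
   space dimension, not the projective one. *)
Record point (F : finFieldType) (k : nat) := Point {
  point_space :> {vspace 'rV[F]_k};
  _ : \dim point_space == 1%N
}.

HB.instance Definition _ (F : finFieldType) (k : nat) :=
  [isSub for @point_space F k].
HB.instance Definition _ (F : finFieldType) (k : nat) :=
  [Choice of point F k by <:].

Definition point_vectors (F : finFieldType) (k : nat) (X : point F k) :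
  {set 'rV[F]_k} := [set v | v \in point_space X].
Definition point_of_vectors (F : finFieldType) (k : nat) (V : {set 'rV[F]_k}) :
  option (point F k) := insub <<enum V>>%VS.

Lemma point_vectorsK (F : finFieldType) (k : nat) :
  pcancel (@point_vectors F k) (@point_of_vectors F k).
Proof.
move=> X; rewrite /point_of_vectors.
suff -> : <<enum (point_vectors X)>>%VS = point_space X by exact: valK.
apply/eqP; rewrite eqEsubv; apply/andP; split.
  by apply/span_subvP => v; rewrite mem_enum inE.
by apply/subvP => v Xv; apply: memv_span; rewrite mem_enum inE.
Qed.

HB.instance Definition _ (F : finFieldType) (k : nat) :=
  Choice_isCountable.Build (point F k) (pcan_pickleK (@point_vectorsK F k)).
HB.instance Definition _ (F : finFieldType) (k : nat) :=
  isFinite.Build (point F k) (pcan_enumP (@point_vectorsK F k)).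

Section ProjectiveGeometry.
Variables (F : finFieldType) (k : nat).
Implicit Types (P G T : {set point F k}) (K : {set F}) (A : 'M[F]_k).

(* Hyperplanes of PG(k-1, F) are the subspaces of F^k of dimension k - 1. *)
Definition general_position P : Prop :=
  #|P| = k.+1 /\
  forall Q : {set point F k}, Q \subset P -> #|Q| = k ->
    ~ exists2 H : {vspace 'rV[F]_k}, \dim H = k.-1 &
        forall X, X \in Q -> (X <= H)%VS.

Definition rational_points K : {set point F k} :=
  [set X | [exists v : 'rV[F]_k,
     [&& v != 0, v \is a mxOver K & point_space X == <[v]>%VS]]].

(* The action on sets of points of the class of A in PGL_k(F), for A
   invertible; matrices act on row vectors on the right. *)
Definition projective_image A T : {set point F k} :=
  [set Y | [exists X in T,
     point_space Y == (linfun (mulmxr A) @: point_space X)%VS]].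

(* A finite field has at most one subfield of each order, so K below is the
   subfield of F with m elements. *)
Definition subgeometry (m : nat) G : Prop :=
  exists K A, [/\ divring_closed K, #|K| = m, A \in unitmx
                & G = projective_image A (rational_points K)].

End ProjectiveGeometry.

(* Main.v *)
Require Import Defs.
From mathcomp Require Import all_boot all_order all_algebra.
From mathcomp Require Import all_field ring.

(* In the coordinates of a frame contained in S, let s be the set of vectors
   whose point lies in S, and let K_ij be the set of ratios x such that
   e_i + x e_j lies in s. Frames formed by two vectors of s and all but two of
   the e_l, the unit vector being completed with suitable F_q-coordinates, show
   that in the chart v_i = 1 coordinates can be replaced by 0 and that s is
   closed under F_q-affine combinations; so, as q > 2, the chart consists of
   the v with v_j in K_ij, and K_ij is an additive group. The subline through
   0, 1 and y makes K_ij closed under inversion, hence a field by Hua's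
   identity. Changing charts shows that K_ij does not depend on i and j. *)

Set Implicit Arguments.
Unset Strict Implicit.
Unset Printing Implicit Defensive.

Import GRing.Theory.

Local Open Scope ring_scope.

(** * Subfields of a finite field *)

Lemma fixed_pow_divring_closed (F : finFieldType) (p n : nat) :
  p \in [pchar F] ->
  divring_closed [set x : F | x ^+ (p ^ n) == x].
Proof.
move=> pF; split=> [|x y|x y]; rewrite !inE ?expr1n // => /eqP xE /eqP yE.
  have pN : [pchar F].-nat (p ^ n)%N by rewrite pnatX pnatE ?pF ?(pcharf_prime pF).
  by rewrite exprDn_pchar // exprNn_pchar // xE yE.
by rewrite expr_div_n xE yE.
Qed.

(** [X^q - X] divides [X^(q^h) - X], the product of all [X - x] over [F]; so it is itself, up to a
    constant, a product of distinct linear factors, [q] in number. *)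
Lemma card_fixed_pow (F : finFieldType) (q h : nat) :
  (1 < q)%N -> (0 < h)%N -> #|F| = (q ^ h)%N ->
  #|[set x : F | x ^+ q == x]| = q.
Proof.
move=> q1 h0 Fq.
have q0 : (0 < q)%N := ltnW q1.
have XE m : (0 < m)%N -> 'X^m - 'X = 'X * ('X^(m.-1) - 1) :> {poly F}.
  by move=> m0; rewrite mulrBr mulr1 -exprS prednK.
have dv : 'X^q - 'X %| \prod_(x <- enum F) ('X - x%:P).
  rewrite big_enum /= -finField_genPoly Fq !XE ?expn_gt0 ?q0 //.
  apply: dvdp_mul => //.
  (* [q - 1] divides [q^h - 1], hence [X^(q-1) - 1] divides [X^(q^h-1) - 1]. *)
  have /dvdnP[m ->] := dvdn_pred_predX q h.
  by rewrite mulnC exprM [X in _ %| X]subrX1 dvdp_mulIl.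
have [m mE] := dvdp_prod_XsubC dv.
set s := mask m (enum F) in mE.
have su : uniq s by rewrite mask_uniq ?enum_uniq.
have szs : size s = q.
  have := eqp_size mE; rewrite size_prod_XsubC => /eqP.
  by rewrite size_polyDl size_polyXn ?size_polyN ?size_polyX // eqSS => /eqP <-.
rewrite -[RHS]szs -(card_uniqP su); apply: eq_card => x.
by rewrite inE -(root_prod_XsubC s) -(eqp_root mE) rootE !hornerE subr_eq0.
Qed.

(** Being closed under addition and natural multiples, [K] is its own span over the prime field;
    this gives access to degrees of field extensions. *)
Lemma divring_closed_subfield (F : finFieldType) (p : nat) (pF : p \in [pchar F])
    (K : {set F}) :
  divring_closed K ->
  exists2 E : {subfield pPrimeCharType pF}, #|K| = (p ^ \dim E)%N & K =i E.
Proof.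
move=> K_field; have [K1 KB KV] := K_field.
have K0 : 0 \in K by rewrite -(subrr 1) KB.
have KD x y : x \in K -> y \in K -> x + y \in K.
  by move=> Kx Ky; rewrite -[y]opprK -[- y]add0r; do 2?apply: (KB).
have KM x y : x \in K -> y \in K -> x * y \in K.
  by move=> Kx Ky; rewrite -[y]invrK -[y^-1]mul1r; do 2?apply: (KV).
set L : splittingFieldType _ := pPrimeCharType pF.
pose V : {vspace L} := <<enum K : seq L>>%VS.
have VK : K =i V.
  move=> x; apply/idP/idP => [Kx|]; first by apply: memv_span; rewrite mem_enum.
  move=> /coord_span ->; elim/big_rec: _ => [|i y _ Ky] //.
  (* Prime field scalars act as multiplication by natural multiples of 1. *)
  apply: (KD) => //; rewrite -[_ *: _]/(_%:R * _); apply: KM.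
    elim: (nat_of_ord _) => [|n IHn]; first by rewrite mulr0n.
    by rewrite mulrS KD.
  by rewrite -mem_enum; apply: mem_nth; rewrite size_tuple ltn_ord.
have aV : is_aspace V.
  apply/andP; split.
    by apply: has_algid1; rewrite -VK.
  by apply/prodvP => x y; rewrite -!VK; apply: KM.
exists (ASpace aV); last exact: VK.
by rewrite (eq_card VK) card_vspace card_Fp ?(pcharf_prime pF).
Qed.

(** Degrees over the prime field, with [q = p^n]: the tower [L], [K], [F] makes [n] divide
    [\dim EK], which divides [n * h]. *)
Lemma divring_closed_card (F : finFieldType) (q h : nat) (L K : {set F}) :
  prime_power q -> #|F| = (q ^ h)%N -> divring_closed L -> #|L| = q ->
  divring_closed K -> L \subset K -> exists2 r, (r %| h)%N & #|K| = (q ^ r)%N.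
Proof.
move=> [p [n [p_pr n0 qE]]] Fq Lf Lq Kf LK.
have pF : p \in [pchar F].
  by apply: (@card_finPcharP _ p (n * h)) => //; rewrite Fq qE expnM.
have p1 := prime_gt1 p_pr.
have [EL cL LE] := divring_closed_subfield pF Lf.
have [EK cK KE] := divring_closed_subfield pF Kf.
have nE : \dim EL = n by apply/eqP; rewrite -(eqn_exp2l _ _ p1) -cL Lq qE.
have /field_dimS : (EL <= EK)%VS.
  by apply/subvP => x; rewrite -LE -KE; apply: (subsetP LK).
rewrite nE => /dvdnP[r rE].
have dE : \dim {: pPrimeCharType pF} = (n * h)%N.
  by rewrite pprimeChar_dimf Fq qE -expnM pfactorK.
have := field_dimS (subvf EK); rewrite dE rE mulnC dvdn_pmul2l // => rh.
by exists r => //; rewrite cK rE qE -expnM mulnC.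
Qed.

(* Hua's identity [a - (a^-1 + (b^-1 - a)^-1)^-1 = a ^ 2 * b] gives products up
   to a factor 2; in characteristic 2, squaring permutes [K]. *)
Lemma divring_closed_of_inv (F : finFieldType) (K : {set F}) :
  1 \in K -> {in K &, forall x y, x - y \in K} -> {in K, forall x, x^-1 \in K} ->
  divring_closed K.
Proof.
move=> K1 KB KV.
have K0 : 0 \in K by rewrite -(subrr 1) KB.
have KN x : x \in K -> - x \in K by move=> Kx; rewrite -[- x]add0r KB.
have KD x y : x \in K -> y \in K -> x + y \in K.
  by move=> Kx Ky; rewrite -[y]opprK KB ?KN.
have Ksq a b : a \in K -> b \in K -> a ^+ 2 * b \in K.
  move=> Ka Kb.
  have [->|a0] := eqVneq a 0; first by rewrite expr0n mul0r.
  have [->|b0] := eqVneq b 0; first by rewrite mulr0.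
  have [ab1|ab1] := eqVneq (a * b) 1; first by rewrite expr2 -mulrA ab1 mulr1.
  have d0 : 1 - a * b != 0 by rewrite subr_eq0 eq_sym.
  suff -> : a ^+ 2 * b = a - (a^-1 + (b^-1 - a)^-1)^-1.
    by apply: (KB) => //; apply/KV/KD; apply: (KV) => //; apply: (KB) => //; apply: KV.
  have -> : b^-1 - a = (1 - a * b) / b by field.
  rewrite invf_div; have -> : a^-1 + b / (1 - a * b) = (a * (1 - a * b))^-1.
    by field; rewrite d0 a0.
  by rewrite invrK; ring.
have KM x y : x \in K -> y \in K -> x * y \in K.
  move=> Kx Ky; have [two0|two0] := eqVneq (2%:R : F) 0.
    have sqK : [set a ^+ 2 | a in K] = K.
      apply/eqP; rewrite eqEcard; apply/andP; split.
        by apply/subsetP => _ /imsetP[a Ka ->]; rewrite -[a ^+ 2]mulr1 Ksq.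
      rewrite card_in_imset // => a b _ _ /eqP; rewrite eqf_sqr => /orP[|] /eqP -> //.
      apply/eqP; rewrite -subr_eq0 -opprD oppr_eq0 -mulr2n -mulr_natl two0.
      by rewrite mul0r.
    by move: Kx; rewrite -{1}sqK => /imsetP[a Ka ->]; apply: Ksq.
  have Kh c : c \in K -> c / 2%:R \in K.
    move=> Kc; suff -> : c / 2%:R = (c^-1 + c^-1)^-1 by apply/KV/KD; apply: KV.
    by rewrite -mulr2n -(mulr_natl c^-1) invfM invrK mulrC.
  (* Polarisation of the quadratic expression [x^2 y]. *)
  have -> : x * y = ((x + 1) ^+ 2 * y - x ^+ 2 * y - y) / 2%:R by field.
  by rewrite Kh ?KB ?Ksq ?KD.
by split=> // x y Kx Ky; apply: KM => //; apply: KV.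
Qed.

(** * Closure under subgeometries, stated for vectors *)

(** The rows of [M], with [c *m M] as unit vector, form a frame; for [t] nonzero the conclusion
    concerns the points of the [L]-subgeometry it determines. *)
Definition frame_closed (F : finFieldType) (k : nat) (L : {set F})
    (s : pred 'rV[F]_k) : Prop :=
  forall (M : 'M_k) (c t : 'rV_k), M \in unitmx ->
  (forall i, s (row i M)) -> (forall i, c 0 i != 0) -> s (c *m M) ->
  t \is a mxOver L -> s ((\row_i (t 0 i * c 0 i)) *m M).

(** * Bases containing all but two standard basis vectors *)

Section LineFrame.
Variables (F : fieldType) (k : nat).
Implicit Types (u v x : 'rV[F]_k).

Definition line_frame (i j : 'I_k) u v : 'M[F]_k :=
  \matrix_l (if l == i then u else if l == j then v else delta_mx 0 l).

Lemma mul_line_frame i j u v x l : i != j ->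
  (x *m line_frame i j u v) 0 l =
  x 0 i * u 0 l + x 0 j * v 0 l + (if (l == i) || (l == j) then 0 else x 0 l).
Proof.
move=> ij; rewrite mxE (bigD1 i) //= (bigD1 j) /=; last by rewrite eq_sym.
rewrite !mxE eqxx [j == i]eq_sym (negbTE ij) eqxx addrA; congr (_ + _).
have rE m : (m != i) && (m != j) ->
    x 0 m * line_frame i j u v m l = x 0 m * (l == m)%:R.
  by case/andP=> /negbTE mi /negbTE mj; rewrite !mxE mi mj mxE.
rewrite (eq_bigr _ rE); case: ifPn => [lij|]; last rewrite negb_or => lij.
  rewrite big1 // => m mij; case: eqP => [lm|_]; last by rewrite mulr0.
  by move: lij mij; rewrite lm -negb_or => ->.
rewrite (bigD1 l) //= eqxx mulr1 big1 ?addr0 // => m /andP[_ /negbTE ml].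
by rewrite eq_sym ml mulr0.
Qed.

(** Coordinates [i] and [j] of the product give a 2 by 2 system in [x 0 i] and [x 0 j]; once these
    vanish, the other coordinates are those of [x]. *)
Lemma line_frame_unit i j u v : i != j ->
  u 0 i * v 0 j - u 0 j * v 0 i != 0 -> line_frame i j u v \in unitmx.
Proof.
move=> ij d0; rewrite -row_free_unit; apply: inj_row_free => x xM.
have E l := mul_line_frame u v x l ij.
have Ei : 0 = x 0 i * u 0 i + x 0 j * v 0 i.
  by move: (E i); rewrite xM eqxx mxE addr0.
have Ej : 0 = x 0 i * u 0 j + x 0 j * v 0 j.
  by move: (E j); rewrite xM eqxx orbT mxE addr0.
(* Cramer's rule, here and for [x 0 j]. *)
have xi : x 0 i = 0.
  apply: (mulIf d0); rewrite mul0r.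
  transitivity ((x 0 i * u 0 i + x 0 j * v 0 i) * v 0 j
                - (x 0 i * u 0 j + x 0 j * v 0 j) * v 0 i); first by ring.
  by rewrite -Ei -Ej !mul0r subr0.
have xj : x 0 j = 0.
  apply: (mulIf d0); rewrite mul0r.
  transitivity ((x 0 i * u 0 j + x 0 j * v 0 j) * u 0 i
                - (x 0 i * u 0 i + x 0 j * v 0 i) * u 0 j); first by ring.
  by rewrite -Ei -Ej !mul0r subr0.
apply/rowP => l; rewrite [RHS]mxE; move: (E l); rewrite xM mxE xi xj !mul0r !add0r.
by case: ifP => [/orP[/eqP->|/eqP->]|_ ->].
Qed.

End LineFrame.

(** * Zeroing coordinates and affine combinations in the chart [v 0 i = 1] *)

Section FrameClosed.
Variables (F : finFieldType) (k : nat) (L : {set F}) (s : pred 'rV[F]_k).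
Hypothesis L_field : divring_closed L.
Implicit Types (u v w x d : 'rV[F]_k).
Hypothesis sZ : forall (a : F) x, a != 0 -> s x -> s (a *: x).
Hypothesis s_closed : frame_closed L s.
Hypothesis s_delta : forall i : 'I_k, s (delta_mx 0 i).
Hypothesis s_ones : s (const_mx 1).

Let L1 : 1 \in L. Proof. by case: L_field. Qed.
Let LB (x y : F) : x \in L -> y \in L -> x - y \in L.
Proof. by case: L_field => _ + _; apply. Qed.
Let LV (x : F) : x \in L -> x^-1 \in L.
Proof. by move=> Lx; rewrite -[x^-1]mul1r; case: L_field => _ _; apply. Qed.
Let L0 : 0 \in L. Proof. by rewrite -(subrr 1) LB. Qed.
Let LD (x y : F) : x \in L -> y \in L -> x + y \in L.
Proof. by move=> Lx Ly; rewrite -[y]opprK -[- y]sub0r !LB. Qed.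
Let LM (x y : F) : x \in L -> y \in L -> x * y \in L.
Proof.
by move=> Lx Ly; rewrite -[y]invrK; case: L_field => _ _; apply=> //; apply: LV.
Qed.

(** This is the subgeometry of the standard frame. *)
Lemma frame_closed_over x : x \is a mxOver L -> s x.
Proof.
move=> Lx.
have := @s_closed 1%:M (const_mx 1) x (unitmx1 _ _).
rewrite !mulmx1 => /(_ _ _ s_ones Lx); set y := (\row_i _ : 'rV_k).
have -> : y = x by apply/rowP => i; rewrite !mxE mulr1.
by apply=> i; rewrite ?row1 ?mxE ?oner_eq0.
Qed.

(** The frame is [line_frame i j u v] with unit vector [w]: [a] and [b] are the coordinates of [w]
    on [u] and [v], and the inequalities make its other coordinates nonzero. *)
Lemma frame_closed_line (i j : 'I_k) u v w (a b t t' : F) :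
  i != j -> u 0 i * v 0 j - u 0 j * v 0 i != 0 -> a != 0 -> b != 0 ->
  s u -> s v -> s w ->
  w 0 i = a * u 0 i + b * v 0 i -> w 0 j = a * u 0 j + b * v 0 j ->
  (forall l, l != i -> l != j -> w 0 l != a * u 0 l + b * v 0 l) ->
  t \in L -> t' \in L -> s ((t * a) *: u + (t' * b) *: v).
Proof.
move=> ij d0 a0 b0 su sv sw wi wj wl Lt Lt'.
pose c : 'rV[F]_k := \row_l (if l == i then a else if l == j then b
                             else w 0 l - (a * u 0 l + b * v 0 l)).
pose y : 'rV[F]_k := \row_l (if l == i then t else if l == j then t' else 0).
have ji : (j == i) = false by rewrite eq_sym (negbTE ij).
have -> : (t * a) *: u + (t' * b) *: v
    = (\row_l (y 0 l * c 0 l)) *m line_frame i j u v.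
  apply/rowP => l; rewrite mul_line_frame // !mxE eqxx ji eqxx.
  by case: (l == i) => //=; case: (l == j) => //=; rewrite ?mul0r ?addr0.
apply: s_closed; first exact: line_frame_unit.
- by move=> l; rewrite rowK; case: ifP => // _; case: ifP.
- move=> l; rewrite mxE; case: ifPn => // li; case: ifPn => // lj.
  by rewrite subr_eq0 wl.
- suff -> : c *m line_frame i j u v = w by [].
  apply/rowP => l; rewrite mul_line_frame // !mxE eqxx ji eqxx.
  case: eqP => [-> |_] /=; first by rewrite addr0.
  by case: eqP => [-> |_] /=; rewrite ?addr0 // addrC subrK.
- by apply/mxOverP => m l; rewrite mxE; do 2?case: ifP.
Qed.

(** In a frame through [v] and [e_j], a unit vector with entry 1 at [i] and 0 at [j] has coordinates
    [1] and [- v 0 j] on these two, whose sum is the vector sought. *)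
Lemma frame_closed_zero (i j : 'I_k) v : i != j -> v 0 i = 1 -> s v ->
  s (\row_l (if l == j then 0 else v 0 l)).
Proof.
move=> ij vi sv; have [vj|vj] := eqVneq (v 0 j) 0.
  suff -> : (\row_l (if l == j then 0 else v 0 l)) = v by [].
  by apply/rowP => l; rewrite mxE; case: eqP => // ->.
(* Off [i] and [j] the entry is whichever of 0 and 1 is sure to differ from [v 0 l]; all entries
   being in [L], [w] lies in [s]. *)
pose w : 'rV[F]_k := \row_l (if l == i then 1 else if l == j then 0
                             else (v 0 l == 0)%:R).
have ji : (j == i) = false by rewrite eq_sym (negbTE ij).
suff -> : (\row_l (if l == j then 0 else v 0 l))
    = (1 * 1) *: v + (1 * - v 0 j) *: delta_mx 0 j.
  apply: (@frame_closed_line i j v (delta_mx 0 j) w) => //.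
  - by rewrite !mxE !eqxx /= (negbTE ij) vi mulr1 mulr0 subr0 oner_eq0.
  - by rewrite oner_eq0.
  - by rewrite oppr_eq0.
  - apply: frame_closed_over; apply/mxOverP => m l; rewrite mxE.
    by do 2?case: ifP => // _; case: eqP.
  - by rewrite !mxE eqxx (negbTE ij) andbF vi mulr1 mulr0 addr0.
  - by rewrite !mxE ji !eqxx mul1r mulr1 subrr.
  move=> l /negbTE li /negbTE lj; rewrite !mxE li lj andbF mulr0 addr0 mul1r.
  by case: (eqVneq (v 0 l) 0) => [->|]; rewrite ?oner_eq0 // eq_sym.
apply/rowP => l; rewrite !mxE eqxx /= !mul1r.
by case: eqP => [->|_]; rewrite ?mulr1 ?mulr0 ?subrr ?addr0.
Qed.

Lemma frame_closed_zeros (i : 'I_k) (r : seq 'I_k) v : i \notin r ->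
  v 0 i = 1 -> s v -> s (\row_l (if l \in r then 0 else v 0 l)).
Proof.
move=> + vi sv; elim: r => [_|j r IHr].
  by have -> : (\row_l (if l \in [::] then 0 else v 0 l)) = v
    by apply/rowP => l; rewrite mxE.
rewrite inE negb_or => /andP[ij ir]; have sr := IHr ir.
have := frame_closed_zero ij _ sr; rewrite mxE (negbTE ir) => /(_ vi).
congr s; apply/rowP => l; rewrite !mxE inE.
by case: (l == j).
Qed.

(** With [j] a coordinate where [u] and [v] differ, [a (u - v)] has entry 0 at [i] and 1 at [j],
    matching a unit vector of zeros and ones. The multipliers [t] and [t - 1] then give [a] times
    the combination. *)
Lemma frame_closed_affine (i : 'I_k) u v t : u 0 i = 1 -> v 0 i = 1 ->
  s u -> s v -> t \in L -> s (t *: u + (1 - t) *: v).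
Proof.
move=> ui vi su sv Lt.
have [-> |/eqP/rowP uv] := eqVneq u v.
  by rewrite -scalerDl addrC subrK scale1r.
have [j ujv] : exists j, u 0 j != v 0 j.
  apply/existsP; rewrite -negb_forall; apply/negP => /forallP E.
  by apply: uv => j; apply/eqP.
have ij : i != j by apply: contraNneq ujv => <-; rewrite ui vi.
have ji : (j == i) = false by rewrite eq_sym (negbTE ij).
have d0 : u 0 j - v 0 j != 0 by rewrite subr_eq0.
pose a := (u 0 j - v 0 j)^-1.
have a0 : a != 0 by rewrite invr_eq0.
pose w : 'rV[F]_k := \row_l (if l == i then 0 else if l == j then 1
                             else (a * u 0 l + - a * v 0 l == 0)%:R).
suff: s ((t * a) *: u + ((t - 1) * - a) *: v).
  move/(sZ d0); rewrite scalerDr !scalerA; congr (s (_ *: _ + _ *: _)).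
    by rewrite /a; field.
  by rewrite /a; field.
apply: (@frame_closed_line i j u v w) => //.
- by rewrite ui vi mul1r mulr1 -opprB oppr_eq0.
- by rewrite oppr_eq0.
- apply: frame_closed_over; apply/mxOverP => m l; rewrite mxE.
  by do 2?case: ifP => // _; case: eqP.
- by rewrite !mxE eqxx ui vi !mulr1 subrr.
- by rewrite !mxE ji eqxx mulNr -mulrBr mulVf.
- move=> l /negbTE li /negbTE lj; rewrite !mxE li lj.
  by case: (eqVneq (_ + _) 0) => [->|]; rewrite ?oner_eq0 // eq_sym.
- exact: LB.
Qed.

(** * The sets of ratios, given an element [t0] of [L] other than 0 and 1 *)

Variable t0 : F.
Hypotheses (Lt0 : t0 \in L) (t00 : t0 != 0) (t01 : t0 != 1).

Lemma frame_closed_scale (i : 'I_k) d t : d 0 i = 0 ->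
  s (delta_mx 0 i + d) -> t \in L -> s (delta_mx 0 i + t *: d).
Proof.
move=> di sd Lt.
have := @frame_closed_affine i _ (delta_mx 0 i) t _ _ sd (s_delta i) Lt.
rewrite !mxE di !eqxx addr0 scalerDr addrAC -scalerDl addrC [t + _]addrC subrK.
by rewrite scale1r addrC; apply.
Qed.

(** Since [t0] and [1 - t0] are invertible, take the affine combination with these weights of
    [e_i + t0^-1 d] and [e_i + (1 - t0)^-1 d']. *)
Lemma frame_closed_add (i : 'I_k) d d' : d 0 i = 0 -> d' 0 i = 0 ->
  s (delta_mx 0 i + d) -> s (delta_mx 0 i + d') -> s (delta_mx 0 i + (d + d')).
Proof.
move=> di di' sd sd'.
have t10 : 1 - t0 != 0 by rewrite subr_eq0 eq_sym.
have sdt := frame_closed_scale di sd (LV Lt0).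
have sdt' := frame_closed_scale di' sd' (LV (LB L1 Lt0)).
have := @frame_closed_affine i _ _ t0 _ _ sdt sdt' Lt0.
rewrite !mxE di di' !eqxx !mulr0 addr0 !scalerDr !scalerA !divff // !scale1r.
rewrite addrACA -scalerDl addrC [t0 + _]addrC subrK scale1r addrC.
exact.
Qed.

Definition ratios (i j : 'I_k) : {set F} :=
  [set x | s (delta_mx 0 i + x *: delta_mx 0 j)].

Lemma over_ratios i j : L \subset ratios i j.
Proof.
apply/subsetP => x Lx; rewrite inE; apply: frame_closed_over.
apply/mxOverP => m l; rewrite !mxE !ord1 eqxx /=.
by apply: LD; [case: (l == i) | apply: LM => //; case: (l == j)].
Qed.

(** One direction zeroes all coordinates but [i] and [j]; the other builds [v] from [e_i] by adding
    one coordinate at a time. *)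
Lemma frame_closed_ratios (i : 'I_k) v : v 0 i = 1 ->
  s v <-> (forall j, j != i -> v 0 j \in ratios i j).
Proof.
move=> vi; split=> [sv j ji|vK].
  rewrite inE.
  have ir : i \notin enum (predC (pred2 i j)) by rewrite mem_enum !inE eqxx.
  have := frame_closed_zeros ir vi sv; congr s; apply/rowP => l.
  rewrite !mxE mem_enum !inE eqxx /=.
  case: (eqVneq l i) => [->|li] /=; first by rewrite eq_sym (negbTE ji) mulr0 addr0.
  by case: (eqVneq l j) => [->|lj] /=; rewrite add0r ?mulr1 ?mulr0.
have {1}-> : v = delta_mx 0 i + \sum_(j | j != i) v 0 j *: delta_mx 0 j.
  by rewrite {1}(row_sum_delta v) (bigD1 i) //= vi scale1r.
(* The vanishing [i]-coordinate is carried along for [frame_closed_add]. *)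
suff [] : s (delta_mx 0 i + \sum_(j | j != i) v 0 j *: delta_mx 0 j)
  /\ (\sum_(j | j != i) v 0 j *: delta_mx 0 j : 'rV[F]_k) 0 i = 0 by [].
elim/big_rec: _ => [|j d ji [sd di]]; first by rewrite addr0 mxE.
have ei : (v 0 j *: delta_mx 0 j : 'rV[F]_k) 0 i = 0.
  by rewrite !mxE eq_sym (negbTE ji) andbF mulr0.
split; last by rewrite mxE di ei addr0.
by apply: frame_closed_add => //; have := vK j ji; rewrite inE.
Qed.

Lemma ratios_scale (i j : 'I_k) (x t : F) : i != j ->
  x \in ratios i j -> t \in L -> t * x \in ratios i j.
Proof.
move=> ij; rewrite !inE -scalerA => sx Lt; apply: frame_closed_scale => //.
by rewrite !mxE (negbTE ij) andbF mulr0.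
Qed.

Lemma ratios_sub (i j : 'I_k) (x y : F) : i != j ->
  x \in ratios i j -> y \in ratios i j -> x - y \in ratios i j.
Proof.
move=> ij Rx Ry.
have := ratios_scale ij Ry (LB L0 L1); move: Rx.
rewrite sub0r mulN1r !inE scalerDl => sx sy.
by apply: frame_closed_add; rewrite // !mxE (negbTE ij) andbF mulr0.
Qed.

Lemma ratios_div (i j : 'I_k) v : i != j -> s v -> v 0 i != 0 ->
  v 0 j / v 0 i \in ratios i j.
Proof.
move=> ij sv vi; rewrite mulrC.
have vi1 : ((v 0 i)^-1 *: v) 0 i = 1 by rewrite mxE mulVf.
have [+ _] := frame_closed_ratios vi1; move=> /(_ _ j); rewrite mxE.
by apply; [apply: sZ; rewrite ?invr_eq0 | rewrite eq_sym].
Qed.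

(* The subline through [e_i], [e_i + e_j] and [e_i + y e_j]. *)
Lemma ratios_subline (i j : 'I_k) (y t : F) : i != j -> y \in ratios i j ->
  y != 0 -> y != 1 -> t \in L -> t + (1 - t) * y != 0 ->
  y / (t + (1 - t) * y) \in ratios i j.
Proof.
move=> ij Ry y0 y1 Lt D0.
have ji : (j == i) = false by rewrite eq_sym (negbTE ij).
have RL l m (x : F) : x \in L -> x \in ratios l m by apply: (subsetP (over_ratios l m)).
pose w : 'rV[F]_k := \row_l (if l == j then y else 1).
have sw : s w.
  apply/(@frame_closed_ratios i) => [|l li]; rewrite !mxE ?(negbTE ij) //.
  by case: eqP => [-> //|_]; apply: RL.
have sij : s (delta_mx 0 i + delta_mx 0 j).
  by have := RL i j 1 L1; rewrite inE scale1r.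
(* At [i] and [j], [w] agrees with [(1 - y) e_i + y (e_i + e_j)]; the multipliers [t] and [1] give a
   vector with the desired ratio. *)
have := @frame_closed_line i j _ _ w (1 - y) y t 1 ij _ _ y0 (s_delta i) sij sw.
rewrite !mxE !eqxx (negbTE ij) ji !andbF /= addr0 add0r !mulr1 !mulr0 ?mul0r.
rewrite subr0 add0r subrK oner_eq0 subr_eq0 eq_sym y1 mul1r.
move=> /(_ isT isT erefl erefl) sv.
have {}sv : s ((t * (1 - y)) *: delta_mx 0 i + y *: (delta_mx 0 i + delta_mx 0 j)).
  apply: sv => // l /negbTE li /negbTE lj.
  by rewrite !mxE li lj andbF addr0 !mulr0 addr0 oner_eq0.
have := ratios_div ij sv.
rewrite !mxE !eqxx (negbTE ij) ji !andbF /= addr0 add0r !mulr1 mulr0 add0r.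
have -> : t * (1 - y) + y = t + (1 - t) * y by ring.
exact.
Qed.

(** The shift [z] is chosen so that the denominator of [ratios_subline] at [y = x - z] becomes
    [(1 - t0) x]. Up to a factor in [L] the lemma then yields [1 - z / x], from which [x^-1] is
    recovered. *)
Lemma ratios_inv (i j : 'I_k) (x : F) : i != j ->
  x \in ratios i j -> x^-1 \in ratios i j.
Proof.
move=> ij Rx; have RL := subsetP (over_ratios i j).
have t10 : 1 - t0 != 0 by rewrite subr_eq0 eq_sym.
have Lt1 : 1 - t0 \in L by apply: LB.
pose z := t0 / (1 - t0).
have Lz : z \in L by apply: LM => //; apply: LV.
have z0 : z != 0 by rewrite mulf_neq0 ?invr_eq0.
have [-> | x0] := eqVneq x 0; first by rewrite invr0 RL.
(* In the two cases that [ratios_subline] excludes, [x] lies in [L]. *)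
have [xz | xz] := eqVneq (x - z) 0.
  by apply/RL/LV; rewrite (subr0_eq xz).
have [xz1 | xz1] := eqVneq (x - z) 1.
  by apply/RL/LV; rewrite -[x](subrK z) xz1; apply: LD.
have D : t0 + (1 - t0) * (x - z) = (1 - t0) * x by rewrite /z; field.
have D0 : t0 + (1 - t0) * (x - z) != 0 by rewrite D mulf_neq0.
have := ratios_subline ij (ratios_sub ij Rx (RL _ Lz)) xz xz1 Lt0 D0.
move=> /(ratios_scale ij)/(_ Lt1)/(ratios_sub ij (RL _ L1)).
move=> /(ratios_scale ij)/(_ (LV Lz)).
rewrite D; suff -> : z^-1 * (1 - (1 - t0) * ((x - z) / ((1 - t0) * x))) = x^-1.
  by [].
by field; rewrite x0 t10 z0.
Qed.

Lemma ratios_field (i j : 'I_k) : i != j -> divring_closed (ratios i j).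
Proof.
move=> ij; apply: divring_closed_of_inv.
- exact: (subsetP (over_ratios i j)).
- by move=> x y; apply: ratios_sub.
- by move=> x; apply: ratios_inv.
Qed.

(** The vector [e_i + x^-1 e_j] lies in [s], and in the chart at [j] its ratio is [x]. *)
Lemma ratios_swap (i j : 'I_k) : i != j -> ratios i j \subset ratios j i.
Proof.
move=> ij; apply/subsetP => x Rx; have [->|x0] := eqVneq x 0.
  exact: (subsetP (over_ratios j i)).
have := ratios_inv ij Rx; rewrite inE => sx.
have ji : j != i by rewrite eq_sym.
have := ratios_div ji sx.
rewrite !mxE !eqxx (negbTE ij) (negbTE ji) /= add0r mulr0 addr0 mulr1.
by rewrite div1r invrK invr_eq0; apply.
Qed.

(** The vector with [x] at [j] and 1 elsewhere has the same entries in the charts at [i] and at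
    [l]. *)
Lemma ratios_base (i l j : 'I_k) : i != j -> l != j ->
  ratios i j \subset ratios l j.
Proof.
move=> ij lj; have [-> //|li] := eqVneq l i.
apply/subsetP => x Rx.
pose v : 'rV[F]_k := \row_m (if m == j then x else 1).
have sv : s v.
  apply/(@frame_closed_ratios i) => [|m mi]; rewrite mxE ?(negbTE ij) //.
  by case: eqP => [-> //|_]; apply: (subsetP (over_ratios i m)).
have := ratios_div lj sv.
by rewrite !mxE eqxx (negbTE lj) divr1 oner_eq0; apply.
Qed.

Lemma ratios_eq (i j i' j' : 'I_k) : i != j -> i' != j' ->
  ratios i j = ratios i' j'.
Proof.
(* The second index is changed by swapping, changing the first, and swapping back. *)
have cg (a b c : 'I_k) : a != b -> a != c -> ratios a b \subset ratios a c.
  move=> ab ac; apply: subset_trans (ratios_swap ab) _.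
  apply: subset_trans (ratios_swap _); last by rewrite eq_sym.
  by apply: ratios_base; rewrite eq_sym.
have sub (a b c d : 'I_k) : a != b -> c != d -> ratios a b \subset ratios c d.
  (* If [c = b], changing the first index would make both indices equal, so a swap comes first. *)
  move=> ab cd; have [cb|cb] := eqVneq c b.
    subst c; apply: subset_trans (ratios_swap ab) _.
    by apply: cg; rewrite // eq_sym.
  by apply: subset_trans (ratios_base ab cb) (cg _ _ _ cb cd).
by move=> ij ij'; apply/eqP; rewrite eqEsubset !sub.
Qed.

(** A nonzero vector is scaled into a chart, where membership is tested entrywise against the common
    field; [1 < k] supplies two indices to define it. The zero vector satisfies both sides. *)
Lemma frame_closed_subfield : (1 < k)%N ->
  exists K : {set F}, [/\ divring_closed K, L \subset K
    & forall v, s v <-> exists2 a, a != 0 & a *: v \is a mxOver K].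
Proof.
move=> k1; pose i0 := Ordinal (ltnW k1); pose i1 := Ordinal k1.
have i01 : i0 != i1 by [].
have Kf := ratios_field i01; have LK := over_ratios i0 i1.
exists (ratios i0 i1); split=> // v.
have [-> | v0] := eqVneq v 0.
  split=> [_|_].
    exists 1; rewrite ?oner_eq0 // scaler0; apply/mxOverP => m l; rewrite mxE.
    exact: (subsetP LK).
  by apply: frame_closed_over; apply/mxOverP => m l; rewrite mxE.
have [i vi] : exists i, v 0 i != 0.
  apply/existsP; rewrite -negb_forall; apply: contra v0 => /forallP E.
  by apply/eqP/rowP => i; rewrite mxE; apply/eqP.
split=> [sv | [a a0 /mxOverP aK]].
  exists (v 0 i)^-1; rewrite ?invr_eq0 //; apply/mxOverP => m j.
  rewrite mxE ord1 mulrC; have [ij | ij] := eqVneq i j.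
    by rewrite -ij divff ?(subsetP LK).
  by rewrite (ratios_eq i01 ij) ratios_div.
rewrite -[v](scalerKV vi); apply: sZ => //.
apply/(@frame_closed_ratios i) => [|j ji]; rewrite mxE ?mulVf // mulrC.
have -> : v 0 j / v 0 i = (a * v 0 j) / (a * v 0 i).
  by field; rewrite a0 vi.
have ij : i != j by rewrite eq_sym.
rewrite (ratios_eq ij i01); case: Kf => _ _; apply.
  by have := aK 0 j; rewrite mxE.
by have := aK 0 i; rewrite mxE.
Qed.

End FrameClosed.

(** * Rescaling a basis so that its unit vector becomes the all-one vector *)

Section Diagonal.
Variables (F : fieldType) (k : nat).
Implicit Type c : 'rV[F]_k.

Lemma diag_mx_unit c : (forall i, c 0 i != 0) -> diag_mx c \in unitmx.
Proof.
by move=> c0; rewrite unitmxE det_diag unitfE; apply/prodf_neq0 => i _; apply: c0.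
Qed.

Lemma delta_mul_diag c i :
  delta_mx 0 i *m diag_mx c = c 0 i *: delta_mx 0 i :> 'rV[F]_k.
Proof.
apply/rowP => l; rewrite mul_mx_diag !mxE /=.
by case: eqP => [->|_]; rewrite ?mulr1 ?mul1r // mulr0 mul0r.
Qed.

Lemma ones_mul_diag c : const_mx 1 *m diag_mx c = c.
Proof. by apply/rowP => l; rewrite mul_mx_diag !mxE mul1r. Qed.

End Diagonal.

(** * Points, the vectors on them, and general position *)

Section Points.
Variables (F : finFieldType) (k : nat).
Implicit Types (X Y Z : point F k) (P S : {set point F k}) (v w : 'rV[F]_k).

Lemma dim_point X : \dim (point_space X) = 1%N.
Proof. by case: X => V /= /eqP. Qed.

Lemma point_line X v : v \in point_space X -> v != 0 -> point_space X = <[v]>%VS.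
Proof.
move=> Xv v0; apply/esym/eqP.
by rewrite eqEdim -memvE Xv dim_point dim_vline v0.
Qed.

Lemma point_eq X Y v : v != 0 -> v \in point_space X -> v \in point_space Y ->
  X = Y.
Proof.
by move=> v0 Xv Yv; apply/val_inj; rewrite /= (point_line Xv) ?(point_line Yv).
Qed.

Lemma vpick_point_neq0 X : vpick X != 0.
Proof. by rewrite vpick0 -dimv_eq0 dim_point. Qed.

Lemma vpick_pointE X : point_space X = <[vpick X]>%VS.
Proof. exact: point_line (memv_pick _) (vpick_point_neq0 _). Qed.

Definition line_point v (v0 : v != 0) : point F k :=
  @Point F k <[v]>%VS (introT eqP (etrans (dim_vline v) (congr1 nat_of_bool v0))).

Lemma mem_image_rational (K : {set F}) (A : 'M_k) Y : A \in unitmx ->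
  (Y \in projective_image A (rational_points k K)) <->
  (exists v, [/\ v != 0, v \is a mxOver K & v *m A \in point_space Y]).
Proof.
move=> uA; rewrite inE; split.
  case/existsP=> X /andP[]; rewrite inE => /existsP[v /and3P[v0 Kv /eqP ->]].
  rewrite limg_line lfunE /= => /eqP YE.
  by exists v; rewrite YE memv_line.
case=> v [v0 Kv Yv]; apply/existsP; exists (line_point v0).
rewrite inE limg_line lfunE /=; apply/andP; split.
  by apply/existsP; exists v; rewrite v0 Kv eqxx.
apply/eqP/point_line => //; apply: contra v0 => /eqP vA.
by rewrite -(mulmxK uA v) vA mul0mx.
Qed.

(** The zero vector qualifies as soon as [S] is nonempty, so only nonzero vectors carry
    information. *)
Definition on_points S v := [exists X in S, v \in point_space X].

Lemma on_pointsZ S a v : on_points S v -> on_points S (a *: v).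
Proof.
case/existsP=> X /andP[SX Xv]; apply/existsP; exists X.
by rewrite SX memvZ.
Qed.

Lemma on_points_vpick S X : on_points S (vpick X) = (X \in S).
Proof.
apply/existsP/idP=> [[Y /andP[SY Yv]] | SX].
  by rewrite (point_eq (vpick_point_neq0 X) (memv_pick _) Yv).
by exists X; rewrite SX memv_pick.
Qed.

(** Rank-nullity: a nonzero linear form has an image of dimension 1. *)
Lemma dim_hyperplane (w : 'cV[F]_k) : w != 0 ->
  \dim (lker (linfun (mulmxr w) : 'Hom('rV[F]_k, 'rV[F]_1))) = k.-1.
Proof.
move=> w0; set f := linfun _.
have dk : (\dim (lker f) + \dim (limg f))%N = k.
  by have := limg_ker_dim f fullv; rewrite capfv => ->; rewrite dimvf /dim /= mul1n.
suff d1 : \dim (limg f) = 1%N by rewrite -[in RHS]dk d1 addn1.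
apply/eqP; rewrite eqn_leq; apply/andP; split.
  by rewrite (leq_trans (dimvS (subvf _))) // dimvf /dim /= mul1n.
rewrite lt0n dimv_eq0; apply: contra w0 => /eqP f0.
apply/eqP/colP => i; rewrite mxE.
have : f (delta_mx 0 i) \in limg f by apply/memv_img/memvf.
rewrite f0 memv0 lfunE /= => /eqP/rowP/(_ 0).
by rewrite -rowE !mxE.
Qed.

(** Otherwise the [k] points of [P] other than [Y] would lie in the hyperplane that is the kernel of
    [w]. *)
Lemma general_position_separates P Y (w : 'cV[F]_k) :
  general_position P -> Y \in P -> w != 0 ->
  exists X, [/\ X \in P, X != Y & vpick X *m w != 0].
Proof.
case=> cP gP PY w0.
have [/existsP[X /and3P[PX XY Xw]]|/existsPn nE] :=
  boolP [exists X, [&& X \in P, X != Y & vpick X *m w != 0]]; first by exists X.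
case: (gP (P :\ Y)); first exact: subD1set.
  by move: cP; rewrite (cardsD1 Y) PY => -[].
exists (lker (linfun (mulmxr w) : 'Hom('rV[F]_k, 'rV[F]_1))).
  exact: dim_hyperplane.
move=> X; rewrite !inE => /andP[XY PX].
rewrite vpick_pointE -memvE memv_ker lfunE /=.
by have := nE X; rewrite PX XY negbK.
Qed.

(** For [k = 1] there is only one point, while general position would require two. *)
Lemma general_position_gt1 P : general_position P -> (0 < k)%N -> (1 < k)%N.
Proof.
move=> [cP _] k0; rewrite ltn_neqAle k0 andbT; apply/eqP => k1.
have : (1 < #|P|)%N by rewrite cP -k1.
case/card_gt1P=> X [Y [_ _ /eqP[]]]; apply/val_inj => /=.
have full Z : point_space Z = fullv.
  by apply/eqP; rewrite eqEdim subvf dim_point dimvf /dim /= -k1.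
by rewrite !full.
Qed.

(** One point [Y] serves as unit vector and the other [k] as basis. A dependency, or a zero
    coordinate of [Y], would put [k] of the points in a hyperplane. *)
Lemma general_position_frame P : general_position P ->
  exists (N : 'M[F]_k) (c : 'rV[F]_k), [/\ N \in unitmx, forall i, c 0 i != 0,
    forall i, on_points P (row i N) & on_points P (c *m N)].
Proof.
move=> gP; have [cP _] := gP.
have [Y PY] : exists Y, Y \in P by apply/card_gt0P; rewrite cP.
have cQ : #|P :\ Y| = k by move: cP; rewrite (cardsD1 Y) PY => -[].
pose e i : point F k := enum_val (cast_ord (esym cQ) i).
have eP i : e i \in P.
  by have := enum_valP (cast_ord (esym cQ) i); rewrite inE => /andP[].
have eE X : X \in P -> X != Y -> exists i, X = e i.
  move=> PX XY; have QX : X \in P :\ Y by rewrite !inE XY.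
  exists (cast_ord cQ (enum_rank_in QX X)).
  by rewrite /e cast_ordK enum_rankK_in.
pose N : 'M[F]_k := \matrix_i vpick (e i).
have uN : N \in unitmx.
  (* After transposing, a kernel vector is a linear form vanishing on all rows of [N]. *)
  rewrite -unitmx_tr -row_free_unit; apply: inj_row_free => x xN.
  apply/eqP; apply: contraTT isT => x0.
  have w0 : x^T != 0 by rewrite trmx_eq0.
  have [X [PX XY /eqP[]]] := general_position_separates gP PY w0.
  have [i ->] := eE X PX XY.
  have := congr1 trmx xN; rewrite trmx_mul trmxK trmx0 => /(congr1 (row i)).
  by rewrite row_mul rowK row0.
exists N, (vpick Y *m invmx N); split=> // [i|i|].
(* This form reads the [i]-th coordinate in the basis [N]; it kills the other basis points. *)
- pose w := invmx N *m delta_mx i 0 : 'cV[F]_k.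
  have w0 : w != 0.
    apply/eqP => /(congr1 (mulmx N)); rewrite mulmx0 mulKVmx // => /colP/(_ i)/eqP.
    by rewrite !mxE !eqxx oner_eq0.
  have [X [PX Xi Xw]] := general_position_separates gP (eP i) w0.
  have [XY | XY] := eqVneq X Y.
    apply: contra Xw => /eqP ci; apply/eqP/rowP => j.
    by rewrite XY mulmxA -colE mxE ci mxE.
  have [j Xj] := eE X PX XY.
  have ji : j != i by apply: contraNneq Xi => <-; rewrite Xj.
  case/eqP: Xw; have -> : vpick X = row j N by rewrite rowK Xj.
  rewrite mulmxA -row_mul mulmxV // row1.
  by rewrite mul_delta_mx_cond (negbTE ji).
- by rewrite rowK on_points_vpick.
- by rewrite mulmxKV // on_points_vpick.
Qed.

(** * From a basis and a unit vector back to points in general position *)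

Section Frame.
Variables (M : 'M[F]_k) (c : 'rV[F]_k) (X : 'I_k -> point F k) (Y : point F k).
Hypotheses (k1 : (1 < k)%N) (uM : M \in unitmx) (c0 : forall i, c 0 i != 0).
Hypotheses (XM : forall i, row i M \in point_space (X i))
  (YM : c *m M \in point_space Y).

Let M0 i : row i M != 0.
Proof.
apply/eqP => /(congr1 (mulmx^~ (invmx M))); rewrite mul0mx -row_mul mulmxV // row1.
by move/rowP/(_ i)/eqP; rewrite !mxE !eqxx oner_eq0.
Qed.

Let XE i v : v \in point_space (X i) -> exists a, v *m invmx M = a *: delta_mx 0 i.
Proof.
rewrite (point_line (XM i) (M0 i)) => /vlineP[a ->]; exists a.
by rewrite -scalemxAl -row_mul mulmxV // row1.
Qed.

Lemma frame_points_inj : injective X.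
Proof.
move=> i j Xij; apply/eqP; apply: contraTT isT => ij.
have [a] : exists a, row i M *m invmx M = a *: delta_mx 0 j.
  by apply: XE; rewrite -Xij.
rewrite -row_mul mulmxV // row1 => /rowP/(_ i)/eqP.
by rewrite !mxE !eqxx (negbTE ij) mulr0 oner_eq0.
Qed.

Lemma frame_points_notin i : Y != X i.
Proof.
apply/eqP => YX.
have [a] : exists a, (c *m M) *m invmx M = a *: delta_mx 0 i.
  by apply: XE; rewrite -YX.
rewrite mulmxK // => cE.
have [j ji] : exists j : 'I_k, j != i.
  have [i0|i0] := eqVneq i (Ordinal k1).
    by exists (Ordinal (ltnW k1)); rewrite i0.
  by exists (Ordinal k1); rewrite eq_sym.
by have := c0 j; rewrite cE !mxE (negbTE ji) andbF mulr0 eqxx.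
Qed.

(** Any [k] of the points span the space: if [X i] is the one left out, [row i M] is recovered from
    [c *m M] and the other rows, as [c 0 i] is nonzero. *)
Lemma frame_general_position : general_position (Y |: [set X i | i : 'I_k]).
Proof.
set P := _ |: _.
have YX : Y \notin [set X i | i : 'I_k].
  by apply/imsetP => -[i _ /eqP]; apply/negP/frame_points_notin.
have cP : #|P| = k.+1.
  by rewrite cardsU1 YX card_imset ?card_ord //; apply: frame_points_inj.
split=> // Q QP cQ [H dH QH].
have /eqP/cards1P[Z PQ] : #|P :\: Q| = 1%N.
  by rewrite cardsD (setIidPr QP) cP cQ subSnn.
have inQ X' : X' \in P -> X' != Z -> X' \in Q.
  move=> PX; apply: contraR => nQ; rewrite -in_set1 -PQ inE nQ; exact: PX.
have XP i : X i \in P by rewrite !inE imset_f ?orbT.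
have inH v X' : v \in point_space X' -> X' \in P -> X' != Z -> v \in H.
  by move=> Xv PX XZ; apply: subvP Xv; apply/QH/inQ.
have MH i : row i M \in H.
  have [XZ|XZ] := eqVneq (X i) Z; last exact: inH (XM i) (XP i) XZ.
  have YH : c *m M \in H.
    by apply: inH YM _ _; rewrite ?setU11 // -XZ frame_points_notin.
  rewrite -[row i M](scalerK (c0 i)) memvZ //.
  have -> : c 0 i *: row i M = c *m M - \sum_(j | j != i) c 0 j *: row j M.
    by rewrite mulmx_sum_row (bigD1 i) //= addrK.
  rewrite memvB // memv_suml // => j ji; rewrite memvZ //.
  by apply: inH (XM j) (XP j) _; rewrite -XZ (inj_eq frame_points_inj).
have : (fullv <= H)%VS.
  apply/subvP => v _; rewrite -(mulmxKV uM v) mulmx_sum_row.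
  by rewrite memv_suml // => i _; rewrite memvZ.
move/dimvS; rewrite dH dimvf /dim /= mul1n.
by case: (k) k1 => // m _; rewrite ltnn.
Qed.

End Frame.

(** Rescaling by [c] turns the frame into the image under [A] of the standard one, so the image of
    the [L]-rational points is a subgeometry of order [q] containing it. *)
Lemma on_points_frame_closed (S : {set point F k}) (L : {set F}) q :
  (1 < k)%N -> divring_closed L -> #|L| = q ->
  (forall P : {set point F k}, P \subset S -> general_position P ->
     forall G : {set point F k}, subgeometry q G -> P \subset G -> G \subset S) ->
  frame_closed L (on_points S).
Proof.
move=> k1 Lf cL Scl M c t uM SM c0 ScM Lt.
have [L1 LB _] := Lf.
have L0 : 0 \in L by rewrite -(subrr 1) LB.
pose A := diag_mx c *m M.
have tA : (\row_i (t 0 i * c 0 i)) *m M = t *m A.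
  rewrite mulmxA; congr (_ *m M); apply/rowP => i.
  by rewrite mul_mx_diag !mxE.
have uA : A \in unitmx by rewrite unitmx_mul uM diag_mx_unit.
have /fin_all_exists[X XP] (i : 'I_k) : exists Z, Z \in S /\ row i M \in point_space Z.
  by have /existsP[Z /andP[]] := SM i; exists Z.
have /existsP[Y /andP[SY YM]] := ScM.
have gP := frame_general_position k1 uM c0 (fun i => (XP i).2) YM.
rewrite tA; have [->|t0] := eqVneq t 0.
  by rewrite mul0mx; apply/existsP; exists Y; rewrite SY mem0v.
have tA0 : t *m A != 0.
  by apply: contra t0 => /eqP tA0; rewrite -(mulmxK uA t) tA0 mul0mx.
apply/existsP; exists (line_point tA0); rewrite memv_line andbT.
have /subsetP : projective_image A (rational_points k L) \subset S.
  apply: Scl gP _ _ _.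
  - apply/subsetP => Z /setU1P[-> //|/imsetP[i _ ->]]; exact: (XP i).1.
  - by exists L, A.
  apply/subsetP => Z /setU1P[-> |/imsetP[i _ ->]]; apply/mem_image_rational => //.
    exists (const_mx 1); split.
    - by apply/eqP => /rowP/(_ (Ordinal k1))/eqP; rewrite !mxE oner_eq0.
    - by apply/mxOverP => m l; rewrite mxE.
    by rewrite mulmxA ones_mul_diag.
  exists (delta_mx 0 i); split.
  - by apply/eqP => /rowP/(_ i)/eqP; rewrite !mxE !eqxx oner_eq0.
  - by apply/mxOverP => m l; rewrite mxE; case: andP.
  by rewrite mulmxA delta_mul_diag -scalemxAl memvZ // -rowE (XP i).2.
by apply; apply/mem_image_rational => //; exists t; rewrite memv_line.
Qed.

End Points.

(** * The subfield of order [q] and the coordinates of the resulting subgeometry *)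

Theorem theorem2p4 (q k h : nat) (F : finFieldType) (S : {set point F k})
  (hq : prime_power q) (hq2 : (2 < q)%N) (hk : (1 <= k)%N) (hh : (1 <= h)%N)
  (hF : #|F| = (q ^ h)%N)
  (hframe : exists P : {set point F k},
     P \subset S /\ general_position P)
  (hclosed : forall P : {set point F k},
     P \subset S -> general_position P ->
     forall G : {set point F k}, subgeometry q G -> P \subset G -> G \subset S) :
  exists r : nat, (r %| h)%N /\ subgeometry (q ^ r)%N S.
Proof.
have [P [PS gP]] := hframe.
have k1 := general_position_gt1 gP hk.
pose L := [set x : F | x ^+ q == x].
have cL : #|L| = q := card_fixed_pow (ltnW hq2) hh hF.
have Lf : divring_closed L.
  case: hq => p [n [p_pr _ qE]]; rewrite /L qE; apply: fixed_pow_divring_closed.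
  by apply: (@card_finPcharP _ p (n * h)) => //; rewrite hF qE expnM.
(* Here [q > 2] provides an element of [L] other than 0 and 1. *)
have [t Lt /norP[t0 t1]] : exists2 t, t \in L & ~~ ((t == 0) || (t == 1)).
  have /subsetPn[t Lt] : ~~ (L \subset [set 0; 1]).
    apply/negP => /subset_leq_card.
    by rewrite cL cards2 leqNgt (leq_ltn_trans _ hq2) //; case: eqP.
  by rewrite !inE => ht; exists t.
have [N [c [uN c0 PN PcN]]] := general_position_frame gP.
have PS_on v : on_points P v -> on_points S v.
  case/existsP=> X /andP[PX Xv]; apply/existsP; exists X.
  by rewrite (subsetP PS).
(* In the coordinates given by [A], the frame found in [P] is the standard one. *)
pose A := diag_mx c *m N.
have uA : A \in unitmx by rewrite unitmx_mul uN diag_mx_unit.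
pose s : pred 'rV[F]_k := fun x => on_points S (x *m A).
have sZ a x : a != 0 -> s x -> s (a *: x).
  by move=> _; rewrite /s -scalemxAl; apply: on_pointsZ.
have s_closed : frame_closed L s.
  move=> M b x uM sM b0 sbM Lx; rewrite /s -mulmxA.
  apply: (on_points_frame_closed k1 Lf cL hclosed) => //.
  - by rewrite unitmx_mul uM.
  - by move=> i; rewrite row_mul; apply: sM.
  - by rewrite mulmxA; apply: sbM.
have s_delta (i : 'I_k) : s (delta_mx 0 i).
  by rewrite /s mulmxA delta_mul_diag -scalemxAl -rowE; apply/on_pointsZ/PS_on.
have s_ones : s (const_mx 1).
  by rewrite /s mulmxA ones_mul_diag; apply: PS_on.
have [K [Kf LK sK]] :=
  frame_closed_subfield Lf sZ s_closed s_delta s_ones Lt t0 t1 k1.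
have [r rh cK] := divring_closed_card hq hF Lf cL Kf LK.
exists r; split=> //; exists K, A; split=> //.
apply/setP => X; apply/idP/idP => [SX | /mem_image_rational].
  apply/mem_image_rational => //.
  have /sK[a a0 Ka] : s (vpick X *m invmx A).
    by rewrite /s mulmxKV // on_points_vpick.
  exists (a *: (vpick X *m invmx A)); split=> //.
    rewrite scaler_eq0 (negbTE a0) /=.
    apply: contra (vpick_point_neq0 X) => /eqP XA.
    by rewrite -(mulmxKV uA (vpick X)) XA mul0mx.
  by rewrite -scalemxAl mulmxKV // memvZ // memv_pick.
case=> // v [v0 Kv Xv].
(* As [v *m A] is nonzero, the point of [S] through it can only be [X]. *)
have /existsP[Z /andP[SZ Zv]] : s v.
  by apply/sK; exists 1; rewrite ?oner_eq0 ?scale1r.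
suff -> : X = Z by [].
apply: point_eq Xv Zv; apply: contra v0 => /eqP vA.
by rewrite -(mulmxK uA v) vA mul0mx.
Qed.
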